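(* Let $G$ be a connected graph of order $n\geq 3$. Then $G$ has exactly three distinct normalized Laplacian eigenvalues, one of which equals $1$, if and only if either $G\cong K_{s,n-s}$ for some $1\leq s\leq n-1$, or $G\cong K_{n_1,n_2,\ldots,n_r}$ with $n_1=n_2=\cdots=n_r=\frac{n}{r}$ and $3\leq r\leq n-1$.
   Context: $K_{n_1,\ldots,n_r}$ denotes the complete multipartite graph with $r$ parts of sizes $n_1,\ldots,n_r$. For a graph with adjacency matrix $A$ and diagonal degree matrix $D$ (no isolated vertices), the normalized Laplacian is $\mathcal{L}=I-D^{-1/2}AD^{-1/2}$, and its eigenvalues are the normalized Laplacian eigenvalues. *)

(* Defs.v *)
From HB Require Import structures.
From mathcomp Require Import all_boot all_order all_algebra.
Set Implicit Arguments. Unset Strict Implicit. Unset Printing Implicit Defensive.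
Import Order.TTheory GRing.Theory Num.Theory.
Local Open Scope ring_scope.

(* A simple graph on vertex set 'I_n is a symmetric irreflexive relation adj. *)

Definition deg n (adj : rel 'I_n) (x : 'I_n) : nat := #|[pred y | adj x y]|.

Definition adjmx (R : rcfType) n (adj : rel 'I_n) : 'M[R]_n :=
  \matrix_(i, j) (adj i j)%:R.

Definition deg_inv_sqrt (R : rcfType) n (adj : rel 'I_n) : 'M[R]_n :=
  diag_mx (\row_i (Num.sqrt ((deg adj i)%:R : R))^-1).

Definition normLap (R : rcfType) n (adj : rel 'I_n) : 'M[R]_n :=
  1%:M - deg_inv_sqrt R adj *m adjmx R adj *m deg_inv_sqrt R adj.

Definition connected_graph n (adj : rel 'I_n) : Prop :=
  forall x y : 'I_n, connect adj x y.

(* complete multipartite graph K_{ns 0, ..., ns (r-1)}: vertices are pairs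
   (part i, index within part i), adjacent iff in different parts *)
Definition Kmulti_vertex r (ns : 'I_r -> nat) := {i : 'I_r & 'I_(ns i)}.
Definition Kmulti r (ns : 'I_r -> nat) : rel (Kmulti_vertex ns) :=
  fun u v => tag u != tag v.

Definition graph_iso (V1 V2 : Type) (e1 : rel V1) (e2 : rel V2) : Prop :=
  exists f : V1 -> V2, bijective f /\ forall x y, e1 x y = e2 (f x) (f y).
Arguments Kmulti {r} ns.

(* Main.v *)
(* If the spectrum of [L = I - B] is [{0, 1, c}], then [L (L - 1) (L - c) = 0],
   and as the kernel of [L] is spanned by the vector of the [sqrt d_i], the
   symmetric matrix [(L - 1) (L - c)] is a multiple of [(sqrt (d_i d_j))_ij].
   With [mu = 1 - c], entrywise:
     [sum_(k ~ i, k ~ j) 1 / d_k = mu a_ij + C d_i d_j].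
   For non-adjacent [i], [j] this forces equal neighbourhoods, so the graph is
   complete multipartite; for adjacent [i], [j] it becomes
     [C d_i^2 + 1 - n / d_j = mu + C d_i d_j],
   which forces equal degrees as soon as there are three parts. *)
Require Import Defs.
From HB Require Import structures.
From mathcomp Require Import all_boot all_order all_algebra.
From mathcomp Require Import complex ring lra.
Set Implicit Arguments.
Unset Strict Implicit.
Unset Printing Implicit Defensive.
Import Order.TTheory GRing.Theory Num.Theory.
Local Open Scope ring_scope.

(** * Annihilating polynomial of a real symmetric matrix *)

(** By the spectral theorem over [R[i]], the complexified matrix is diagonalised by an invertible
    [P] with real diagonal [d]. In that basis the product is diagonal with entries
    [prod_a (d_i - a)], each of which has a zero factor because [d_i] lies in [s]. *)
Lemma symmetric_annihilated (R : rcfType) n (A : 'M[R]_n) (s : seq R) :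
  A^T = A -> (forall x, eigenvalue A x -> x \in s) ->
  \big[mulmx/1%:M]_(a <- s) (A - a%:M) = 0.
Proof.
move=> symA eigA; pose f : {rmorphism R -> R[i]%C} := real_complex R; set AC := map_mx f A.
have hA : AC \is hermsymmx.
  apply: realsym_hermsym.
    by apply/is_hermitianmxP; rewrite expr0 scale1r map_mx_id // /AC map_trmx symA.
  by apply/mxOverP => i j; rewrite mxE complex_real.
have realA := hermitian_spectral_diag_real hA.
have /hermitian_normalmx/orthomx_spectralP defA := hA.
set P := spectralmx AC in defA; set d := spectral_diag AC in defA realA.
have uP : P \in unitmx by exact: spectral_unit.
have PA : P *m AC = diag_mx d *m P by rewrite {1}defA !mulmxA mulmxV // mul1mx.
(* Row [i] of [P] is an eigenvector over [R[i]]; as [d_i] is real, the characteristic polynomial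
   brings this eigenvalue back to [A] over [R]. *)
have eigd i : exists2 x, x \in s & d 0 i = f x.
  have /mxOverP/(_ 0 i)/complex_realP[x dx] := realA.
  exists x => //; apply: eigA; rewrite eigenvalue_root_char -(fmorph_root f).
  rewrite map_char_poly -/AC (_ : f x = d 0 i) // -eigenvalue_root_char.
  apply/eigenvalueP; exists (row i P).
    by rewrite -row_mul PA row_mul row_diag_mx -scalemxAl -rowE.
  apply/eqP => Pi0; have := uP; rewrite unitmxE unitfE => /negP; apply.
  apply/eqP; rewrite (expand_det_row _ i) big1 // => j _.
  by move/rowP/(_ j): Pi0; rewrite !mxE => ->; rewrite mul0r.
have key t : P *m map_mx f (\big[mulmx/1%:M]_(a <- t) (A - a%:M)) =
    diag_mx (\row_i \prod_(a <- t) (d 0 i - f a)) *m P.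
  elim: t => [|a t IH].
    rewrite big_nil map_mx1 mulmx1 -[LHS]mul1mx; congr (_ *m _).
    by apply/matrixP => i j; rewrite !mxE big_nil.
  rewrite big_cons map_mxM mulmxA map_mxB map_scalar_mx -/AC mulmxBr PA.
  rewrite mul_mx_scalar -mul_scalar_mx -mulmxBl -mulmxA IH mulmxA.
  congr (_ *m _); rewrite -diag_const_mx -raddfB /= mulmx_diag; congr diag_mx.
  by apply/rowP => i; rewrite !mxE big_cons.
apply: (map_mx_inj (f := f)); rewrite map_mx0 -[LHS](mulKmx uP) key.
rewrite [X in diag_mx X](_ : _ = 0) ?raddf0 ?mul0mx ?mulmx0 //.
apply/rowP => i; rewrite !mxE; have [x xs ->] := eigd i.
by apply/eqP; rewrite prodf_seq_eq0; apply/hasP; exists x; rewrite //= subrr.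
Qed.

(** * Eigenvectors of the normalized Laplacian of a connected graph *)

Section NormalizedLaplacian.
Variables (R : rcfType) (n : nat) (adj : rel 'I_n).
Hypotheses (adj_sym : symmetric adj) (adj_conn : connected_graph adj).
Hypothesis n_gt1 : (1 < n)%N.
Local Notation d i := ((deg adj i)%:R : R).
Local Notation L := (normLap R adj).

Lemma deg_gt0 i : (0 < deg adj i)%N.
Proof using adj_conn n_gt1.
have [j neq_ji] : exists j, j != i.
  have /card_gt0P[j] : (0 < #|predC1 i|)%N.
    by rewrite cardC1 card_ord; case: n n_gt1 => [|[]].
  by exists j.
have /connectP[[|k p]] := adj_conn i j; first by move=> _ eji; rewrite eji eqxx in neq_ji.
by move=> /= /andP[ik _] _; apply/card_gt0P; exists k.
Qed.

Lemma degR_gt0 i : 0 < d i.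
Proof using adj_conn n_gt1. by rewrite ltr0n deg_gt0. Qed.

Lemma sqrt_deg_gt0 i : 0 < Num.sqrt (d i).
Proof using adj_conn n_gt1. by rewrite sqrtr_gt0 degR_gt0. Qed.

Lemma normLapE i j :
  L i j = (i == j)%:R - (adj i j)%:R / (Num.sqrt (d i) * Num.sqrt (d j)).
Proof using.
rewrite /normLap /deg_inv_sqrt mul_diag_mx mul_mx_diag !mxE invfM.
by congr (_ - _); rewrite mulrCA mulrA.
Qed.

Lemma normLap_sym : L^T = L.
Proof using adj_sym.
by apply/matrixP => i j; rewrite mxE !normLapE eq_sym adj_sym [X in _ / X]mulrC.
Qed.

(* Scaling by [sqrt (d i)] turns eigenvectors of [L] into solutions of the
   generalized problem [A w = (1 - x) D w], which is free of square roots. *)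
Lemma sum_normLap (w : 'I_n -> R) j :
  \sum_i w i * Num.sqrt (d i) * L i j =
  Num.sqrt (d j) * w j - (\sum_(i | adj j i) w i) / Num.sqrt (d j).
Proof using adj_sym adj_conn n_gt1.
under eq_bigr => i _ do rewrite normLapE mulrBr.
rewrite sumrB (bigD1 j) //= eqxx mulr1 big1 => [|i /negPf->]; last by rewrite mulr0.
rewrite addr0 mulrC; congr (_ - _); rewrite mulr_suml [RHS]big_mkcond /=.
apply: eq_bigr => i _; rewrite adj_sym; case: (adj j i); last by rewrite mul0r mulr0.
by rewrite mul1r; field; rewrite !gt_eqF ?sqrt_deg_gt0.
Qed.

Lemma sqr_sqrt_deg i : Num.sqrt (d i) * Num.sqrt (d i) = d i.
Proof using. by rewrite -expr2 sqr_sqrtr ?ler0n. Qed.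

Lemma eigenvalue_normLapP x :
  eigenvalue L x <->
  exists2 w : 'I_n -> R, exists i, w i != 0 &
    forall j, \sum_(i | adj j i) w i = (1 - x) * d j * w j.
Proof using adj_sym adj_conn n_gt1.
have u0 i : Num.sqrt (d i) != 0 by rewrite gt_eqF ?sqrt_deg_gt0.
split=> [/eigenvalueP[v Lv v0] | [w [i wi0] ws]].
  exists (fun i => v 0 i / Num.sqrt (d i)).
    move/rV0Pn: v0 => [i vi0]; exists i.
    by rewrite mulf_neq0 ?invr_eq0.
  move=> j; have := sum_normLap (fun i => v 0 i / Num.sqrt (d i)) j.
  under eq_bigr => i _ do rewrite divfK //.
  move/rowP/(_ j): Lv; rewrite !mxE => -> Lj; rewrite [X in _ = X - _]mulrC divfK // in Lj.
  have {Lj} : (\sum_(i | adj j i) (v 0 i / Num.sqrt (d i))) / Num.sqrt (d j) = (1 - x) * v 0 j.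
    by rewrite mulrBl Lj; ring.
  move/(canRL (divfK (u0 j))) => ->; rewrite -[X in _ * X * (_ / _)]sqr_sqrt_deg; field.
  exact: u0.
apply/eigenvalueP; exists (\row_i (w i * Num.sqrt (d i))).
  apply/rowP => j; rewrite !mxE; under eq_bigr => k _ do rewrite mxE.
  by rewrite sum_normLap ws -[X in (_ - x) * X * _]sqr_sqrt_deg; field; exact: u0.
by apply/rV0Pn; exists i; rewrite mxE mulf_neq0.
Qed.

Lemma eigenvalue_normLap0 : eigenvalue L 0.
Proof using adj_sym adj_conn n_gt1.
apply/eigenvalue_normLapP; exists (fun=> 1).
  by exists (Ordinal (ltnW n_gt1)); rewrite oner_eq0.
by move=> j; rewrite sumr_const subr0 mul1r mulr1.
Qed.

(* Maximum principle. *)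
Lemma harmonic_const (w : 'I_n -> R) :
  (forall j, \sum_(i | adj j i) w i = d j * w j) -> forall i j, w i = w j.
Proof using adj_conn n_gt1.
move=> harm; pose m := [arg max_(i > Ordinal (ltnW n_gt1)) w i]%O.
have max_m i : w i <= w m by rewrite /m; case: arg_maxP => //= k _; apply.
(* At a vertex attaining the maximum, the non-negative terms [w m - w k] over its neighbours sum to
   zero, so the maximum spreads along edges. *)
have step i j : w i = w m -> adj i j -> w j = w m.
  move=> wi ij; have sum0 : \sum_(k | adj i k) (w m - w k) = 0.
    by rewrite sumrB harm wi sumr_const mulr_natl subrr.
  apply/esym/eqP; rewrite -subr_eq0; apply/eqP; apply: (psumr_eq0P _ sum0) ij.
  by move=> k _; rewrite subr_ge0.
suff wm i : w i = w m by move=> i j; rewrite !wm.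
have along p z : w z = w m -> path adj z p -> w (last z p) = w m.
  elim: p z => [|k p IH] z //= wz /andP[zk kp].
  by apply: IH kp; apply: step zk.
by have /connectP[p mp ->] := adj_conn m i; apply: along.
Qed.

Lemma codegree_identity (c : R) :
  (forall x, eigenvalue L x -> x \in [:: 0; 1; c]) ->
  exists C, forall i j, \sum_(k | adj i k && adj j k) (d k)^-1 =
    (1 - c) * (adj i j)%:R + C * d i * d j.
Proof using adj_sym adj_conn n_gt1.
move=> /(symmetric_annihilated normLap_sym).
rewrite !big_cons big_nil mulmx1 raddf0 subr0.
set M := _ *m (_ - c%:M) => LM0.
have u0 i : Num.sqrt (d i) != 0 by rewrite gt_eqF ?sqrt_deg_gt0.
pose N i j := \sum_(k | adj i k && adj j k) (d k)^-1 - (1 - c) * (adj i j)%:R.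
have symN i j : N i j = N j i.
  by rewrite /N adj_sym; congr (_ - _); apply: eq_bigl => k; rewrite andbC.
have subE (X : 'M[R]_n) e i j : (X - e%:M) i j = X i j - e *+ (i == j).
  by rewrite !mxE.
have defM i j : M i j = N i j / (Num.sqrt (d i) * Num.sqrt (d j)).
  (* With [B = 1 - L], [M = (- B) ((1 - c) - B)]: the first summand, present only for [k = j], is
     [- (1 - c) B], and the second is [B ^ 2]. *)
  have -> : M i j = \sum_k
      ((if k == j then - (1 - c) * (adj i k)%:R / (Num.sqrt (d i) * Num.sqrt (d k)) else 0) +
      (if adj i k && adj j k then (d k)^-1 / (Num.sqrt (d i) * Num.sqrt (d j)) else 0)).
    rewrite mxE; apply: eq_bigr => k _; rewrite !subE !normLapE.
    rewrite (adj_sym k) -[X in X^-1 / _]sqr_sqrt_deg.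
    by case: (i == k); case: (k == j); case: (adj i k); case: (adj j k);
       rewrite /= ?mulr1n ?mulr0n; field; rewrite ?u0.
  rewrite big_split /= -!big_mkcond /= big_pred1_eq -mulr_suml /N.
  by field; rewrite ?u0.
(* Each column of [L M = 0], rescaled by square roots of degrees, says that [k |-> N k j / d k] is
   harmonic, hence constant. *)
have NE i i' j : N i j / d i = N i' j / d i'.
  pose w k := N k j / d k; apply: (harmonic_const (w := w)) => k.
  have : \sum_i w i * Num.sqrt (d i) * L i k = 0.
    transitivity (Num.sqrt (d j) * (L *m M) k j); last by rewrite LM0 mxE mulr0.
    rewrite [(L *m M) k j]mxE mulr_sumr; apply: eq_bigr => l _.
    rewrite defM -[L in RHS]normLap_sym [L^T k l]mxE /w -[X in _ / X * _]sqr_sqrt_deg.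
    by field; rewrite ?u0.
  rewrite sum_normLap => /eqP; rewrite subr_eq0 => /eqP/esym/(canRL (divfK (u0 k))).
  by rewrite mulrAC sqr_sqrt_deg.
pose o := Ordinal (ltnW n_gt1); exists (N o o / d o / d o) => i j.
have d0 k : d k != 0 by rewrite gt_eqF ?degR_gt0.
(* Constancy in the first argument, used twice through the symmetry of [N], reduces every entry to
   [N o o]. *)
have defN : N i j = N o o / d o / d o * d i * d j.
  have /(canRL (divfK (d0 i))) -> := NE i o j.
  rewrite (symN o j); have /(canRL (divfK (d0 j))) -> := NE j o o.
  by ring.
by rewrite -defN /N addrC subrK.
Qed.

Hypothesis adj_irr : irreflexive adj.

(** For eigenvalue 1 the neighbour sums of [w] vanish. In a complete graph each [w j] would then
    equal the total sum, so [w] would be constant and [n w = w], impossible for [w != 0] and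
    [n > 1]. *)
Lemma eigenvalue1_nonadjacent : eigenvalue L 1 ->
  exists x y, x != y /\ ~~ adj x y.
Proof using adj_sym adj_conn n_gt1 adj_irr.
move=> /eigenvalue_normLapP[w [p wp0] ws].
case: (boolP [exists x, exists y, (x != y) && ~~ adj x y]) => [|complete].
  by move=> /existsP[x /existsP[y /andP[]]]; exists x, y.
have complete_adj x y : x != y -> adj x y.
  move=> xy; apply: contraNT complete => nadj.
  by apply/existsP; exists x; apply/existsP; exists y; rewrite xy.
have sumw j : w j = \sum_i w i.
  rewrite (bigID (adj j)) /= ws subrr !mul0r add0r (bigD1 j) ?adj_irr //=.
  by rewrite big1 ?addr0 // => i /andP[ji ij]; rewrite complete_adj // eq_sym in ji.
have : \sum_i w i = n%:R * w p.
  by rewrite (eq_bigr (fun=> w p)) => [|i _]; rewrite ?sumr_const ?card_ord ?mulr_natl // !sumw.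
move=> /eqP; rewrite -(sumw p) -subr_eq0 -{1}[w p]mul1r -mulrBl mulf_eq0 (negPf wp0) orbF.
by rewrite subr_eq0 (eqr_nat R 1) eq_sym gtn_eqF.
Qed.

(** * Consequences of the codegree identity *)

Section Codegree.
Variables mu C : R.
Hypothesis codegree : forall i j,
  \sum_(k | adj i k && adj j k) (d k)^-1 = mu * (adj i j)%:R + C * d i * d j.

Lemma sum_inv_deg i : \sum_(k | adj i k) (d k)^-1 = C * d i * d i.
Proof using codegree adj_irr.
have := codegree i i; rewrite adj_irr mulr0 add0r => <-.
by apply: eq_bigl => k; rewrite andbb.
Qed.

Lemma codegree_const_gt0 : 0 < C.
Proof using codegree adj_irr adj_conn n_gt1.
have d_gt0 := degR_gt0; pose o := Ordinal (ltnW n_gt1).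
have : 0 < C * d o * d o.
  rewrite -sum_inv_deg; have /card_gt0P[k ok] := deg_gt0 o.
  rewrite (bigD1 k) //= ltr_pwDl ?invr_gt0 ?d_gt0 //.
  by apply: sumr_ge0 => l _; rewrite invr_ge0 ltW.
by rewrite -mulrA pmulr_lgt0 ?mulr_gt0 ?d_gt0.
Qed.

(** This is the codegree identity at [(i, j)] subtracted from the one at [(i, i)]. *)
Lemma sum_inv_deg_diff i j :
  \sum_(k | adj i k && ~~ adj j k) (d k)^-1 = C * d i * (d i - d j) - mu * (adj i j)%:R.
Proof using codegree adj_irr.
have := sum_inv_deg i; rewrite (bigID (adj j)) /= codegree.
by move=> /(canRL (addKr _)) ->; ring.
Qed.

(* For non-adjacent [i], [j] the difference of neighbourhoods has weight
   [C d_i (d_i - d_j) >= 0]; exchanging [i] and [j] forces both to vanish. *)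
Lemma nonadjacent_twins i j : ~~ adj i j -> adj i =1 adj j.
Proof using codegree adj_irr adj_sym adj_conn n_gt1.
have d_gt0 := degR_gt0; have C_gt0 := codegree_const_gt0.
have sum_ge0 a b : 0 <= \sum_(k | adj a k && ~~ adj b k) (d k)^-1.
  by apply: sumr_ge0 => l _; rewrite invr_ge0 ltW.
move=> nij; have nji : ~~ adj j i by rewrite adj_sym.
have le_deg a b : ~~ adj a b -> d b <= d a.
  move=> nab; have := sum_ge0 a b; rewrite sum_inv_deg_diff (negPf nab) mulr0 subr0.
  by rewrite pmulr_rge0 ?mulr_gt0 ?d_gt0 // subr_ge0.
have eq_deg : d i = d j by apply/eqP; rewrite eq_le !le_deg.
have sub a b k : ~~ adj a b -> d a = d b -> adj a k -> adj b k.
  move=> nab eab ak; apply: contraT => nbk.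
  have sum0 : \sum_(l | adj a l && ~~ adj b l) (d l)^-1 = 0.
    by rewrite sum_inv_deg_diff (negPf nab) eab subrr !mulr0 subrr.
  have /eqP : (d k)^-1 = 0.
    by apply: (psumr_eq0P _ sum0); rewrite ?ak // => l _; rewrite invr_ge0 ltW.
  by rewrite invr_eq0 gt_eqF ?d_gt0.
by move=> k; apply/idP/idP; apply: sub.
Qed.

Lemma nonadjacent_deg i j : ~~ adj i j -> deg adj i = deg adj j.
Proof using codegree adj_irr adj_sym adj_conn n_gt1.
by move=> /nonadjacent_twins ij; apply: eq_card => k; rewrite !inE ij.
Qed.

Lemma nonadjacent_card j : #|[pred k | ~~ adj j k]| = (n - deg adj j)%N.
Proof using.
have := cardC [pred k | adj j k]; rewrite card_ord /deg => cardC.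
by rewrite -[X in (X - _)%N]cardC addKn; apply: eq_card.
Qed.

(** A non-neighbour [k] of [j] is a twin of [j], so it is adjacent to [i] and has degree [d j]. The
    neighbours of [i] outside those of [j] are thus the [n - d j] non-neighbours of [j], of total
    weight [n / d j - 1]. *)
Lemma adjacent_deg_equation i j : adj i j ->
  C * d i * d i + 1 - n%:R / d j = mu + C * d i * d j.
Proof using codegree adj_irr adj_sym adj_conn n_gt1.
move=> ij; have := sum_inv_deg_diff i j; rewrite ij mulr1.
have -> : \sum_(k | adj i k && ~~ adj j k) (d k)^-1 = n%:R / d j - 1.
  rewrite (eq_bigl [pred k | ~~ adj j k]) => [|k /=]; last first.
    case: (boolP (adj j k)) => [|njk]; rewrite ?andbF ?andbT //.
    by rewrite adj_sym -(nonadjacent_twins njk) adj_sym.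
  rewrite (eq_bigr (fun=> (d j)^-1)) => [|k /= /nonadjacent_deg -> //].
  rewrite sumr_const nonadjacent_card -[_ *+ (_ - _)]mulr_natl natrB.
    by rewrite mulrBl divff // gt_eqF ?degR_gt0.
  by rewrite -[X in (_ <= X)%N]card_ord max_card.
by move=> /eqP; rewrite subr_eq => /eqP ->; ring.
Qed.

(** The edge equation is applied to the three edges in both directions; what remains is algebra in
    the three degrees [a], [b], [c]. *)
Lemma triangle_deg x y z : adj x y -> adj x z -> adj y z -> deg adj x = deg adj y.
Proof using codegree adj_irr adj_sym adj_conn n_gt1.
move=> xy xz yz; apply/eqP; rewrite -(eqr_nat R).
have E := adjacent_deg_equation; have C0 := codegree_const_gt0.
have := E _ _ xy; have := E _ _ xz; have := E _ _ yz.
rewrite adj_sym in xy; rewrite adj_sym in xz; rewrite adj_sym in yz.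
have := E _ _ xy; have := E _ _ xz; have := E _ _ yz.
have := degR_gt0 x; have := degR_gt0 y; have := degR_gt0 z.
have : (0 : R) < n%:R by rewrite ltr0n ltnW.
move: (n%:R) (d x) (d y) (d z) => m a b c m0 c0 b0 a0 Ecb Eca Eba Ebc Eac Eab.
(* The right-hand sides for the two directions of an edge agree; the difference of the left-hand
   sides factors through [u - v]. *)
have cases u v : 0 < u -> 0 < v -> C * u * u + 1 - m / v = mu + C * u * v ->
    C * v * v + 1 - m / u = mu + C * v * u -> u != v -> C * u * v * (u + v) = m.
  move=> u0 v0 Euv Evu uv.
  have : (u - v) * (C * u * v * (u + v) - m) = 0.
    transitivity (u * v * ((C * u * u + 1 - m / v) - (C * v * v + 1 - m / u))).
      by field; rewrite !gt_eqF.
    by rewrite Euv Evu; ring.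
  by move=> /eqP; rewrite mulf_eq0 !subr_eq0 (negPf uv) => /eqP.
have same u v : 0 < u -> 0 < v -> C * u * u + 1 - m / v = mu + C * u * v ->
    C * v * v + 1 - m / v = mu + C * v * v -> u = v.
  move=> u0 v0 Euv Evv; apply/eqP; rewrite -subr_eq0.
  have : (C * u) * (u - v) = 0 by lra.
  by move=> /eqP; rewrite mulf_eq0 gt_eqF // mulr_gt0.
case: (eqVneq a b) => // ab; exfalso; move/eqP: (ab); apply.
(* If [c] equals [a] or [b], the edge joining equal degrees forces [a = b] through [same]. Otherwise
   [a b (a + b) = a c (a + c)], and this difference factors as [a (a + b + c) (b - c)]. *)
case: (eqVneq b c) => [bc|bc]; first by apply: same => //; subst.
case: (eqVneq a c) => [ac|ac]; first by apply/esym/same => //; subst.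
have := cases _ _ a0 b0 Eab Eba ab; have := cases _ _ a0 c0 Eac Eca ac => <- h.
have /eqP : (C * a) * (a + b + c) * (b - c) = 0.
  by apply/eqP; rewrite -subr_eq0 in h *; move: h => /eqP h; apply/eqP; lra.
by rewrite !mulf_eq0 subr_eq0 (negPf bc) !gt_eqF // !addr_gt0.
Qed.

End Codegree.
End NormalizedLaplacian.

(** * Isomorphisms with complete multipartite graphs as colourings *)

Section Coloring.
Variables (n r : nat) (adj : rel 'I_n) (ns : 'I_r -> nat).

Lemma graph_iso_of_coloring (c : 'I_n -> 'I_r) :
  (forall i, #|[pred x | c x == i]| = ns i) ->
  (forall x y, adj x y = (c x != c y)) -> graph_iso adj (Kmulti ns).
Proof.
move=> card_c adjE.
pose f x : Kmulti_vertex ns := Tagged (fun i => 'I_(ns i))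
  (cast_ord (card_c (c x)) (enum_rank_in (eqxx (c x) : x \in [pred y | c y == c x]) x)).
pose g (u : Kmulti_vertex ns) : 'I_n :=
  enum_val (cast_ord (esym (card_c (tag u))) (tagged u)).
have c_g u : c (g u) = tag u by apply/eqP; have := enum_valP (cast_ord (esym (card_c (tag u))) (tagged u)).
have fK : cancel f g.
  by move=> x; rewrite /g /= cast_ordK enum_rankK_in // inE.
(* Here both tags are free, so their equality can be eliminated; [cancel g f] then follows from [fK]
   without transporting ranks along [c (g u) = tag u]. *)
have g_inj : injective g.
  move=> u v guv; have := c_g u; rewrite guv c_g.
  case: u v guv => i a [j b] /= guv eji; case: _ / eji a guv => a.
  by move=> /enum_val_inj/cast_ord_inj /= ->.
have gK : cancel g f by move=> u; apply: g_inj; rewrite fK.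
exists f; split; first by exists g.
by move=> x y; rewrite adjE.
Qed.

Lemma coloring_of_graph_iso : graph_iso adj (Kmulti ns) ->
  exists2 c : 'I_n -> 'I_r, forall i, #|[pred x | c x == i]| = ns i &
    forall x y, adj x y = (c x != c y).
Proof.
move=> [f [[g fK gK] adjE]]; exists (fun x => tag (f x)) => // i.
rewrite -[RHS]card_ord.
rewrite -(card_image (f := fun a : 'I_(ns i) => g (Tagged _ a))) => [|a b /(can_inj gK)]; last first.
  by apply: eq_from_Tagged.
apply: eq_card => x; rewrite !inE; apply/eqP/imageP => [<-|[a _ ->]]; last by rewrite gK.
exists (tagged (f x)) => //; rewrite -[LHS]fK; congr g; by case: (f x).
Qed.

End Coloring.

(** * Spectra of complete bipartite and balanced multipartite graphs *)

Section Multipartite.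
Variables (R : rcfType) (n r : nat) (adj : rel 'I_n) (c : 'I_n -> 'I_r).
Hypotheses (adj_conn : connected_graph adj) (n_gt1 : (1 < n)%N).
Hypothesis adjE : forall x y, adj x y = (c x != c y).
Local Notation L := (normLap R adj).
Local Notation d i := ((deg adj i)%:R : R).

Let adj_sym : symmetric adj.
Proof. by move=> x y; rewrite !adjE eq_sym. Qed.

(** By pigeonhole two vertices share a colour, hence a neighbourhood, and the difference of their
    indicators has zero neighbour sums. *)
Lemma multipartite_eigenvalue1 : (r < n)%N -> eigenvalue L 1.
Proof.
move=> lt_rn.
have [x [y [neq_xy eq_c]]] : exists x y, x != y /\ c x = c y.
  have /injectivePn[x [y xy cxy]] : ~~ injectiveb c.
    by apply/negP => /injectiveP/leq_card; rewrite !card_ord leqNgt lt_rn.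
  by exists x, y.
apply/eigenvalue_normLapP => //.
exists (fun i => (i == x)%:R - (i == y)%:R).
  by exists x; rewrite eqxx (negPf neq_xy) subr0 oner_eq0.
move=> j; rewrite subrr !mul0r sumrB.
have sum_ind z : \sum_(i | adj j i) (i == z)%:R = (adj j z)%:R :> R.
  rewrite big_mkcond (bigD1 z) //= eqxx big1 ?addr0 => [|i /negPf->].
    by case: (adj j z).
  by rewrite if_same.
by rewrite !sum_ind !adjE eq_c subrr.
Qed.

Lemma multipartite_sum (w : 'I_n -> R) j :
  \sum_(i | adj j i) w i = \sum_i w i - \sum_(i | c i == c j) w i.
Proof.
rewrite [in RHS](bigID (adj j)) /= [X in _ + X - _](eq_bigl (fun i => c i == c j)).
  by rewrite addrK.
by move=> i; rewrite adjE negbK eq_sym.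
Qed.

(** For [x != 1] an eigenfunction is constant on each side, and crossing an edge multiplies it by
    [1 - x]. Crossing back gives [(1 - x) ^ 2 = 1], that is, [x = 0] or [x = 2]. *)
Lemma eigenvalue_bipartite x : r = 2%N -> (2 < n)%N ->
  eigenvalue L x <-> x = 0 \/ x = 1 \/ x = 2.
Proof.
move=> r2 n_gt2.
have c_lt2 i : (c i < 2)%N by rewrite -[X in (_ < X)%N]r2.
have two i j k : adj i j -> adj i k -> c j = c k.
  rewrite !adjE => ij ik; apply/val_inj.
  move: ij ik (c_lt2 i) (c_lt2 j) (c_lt2 k); rewrite -!val_eqE /=.
  by case: (nat_of_ord (c i)) (nat_of_ord (c j)) (nat_of_ord (c k)) => [|[|?]] [|[|?]] [|[|?]].
split=> [/eigenvalue_normLapP - /(_ adj_sym adj_conn n_gt1)[w [p wp0] ws]|].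
  case: (eqVneq x 1) => [|x1]; first by right; left.
  have d0 i : d i != 0 by rewrite gt_eqF ?degR_gt0.
  have l0 : 1 - x != 0 by rewrite subr_eq0 eq_sym.
  have w_c i j : c i = c j -> w i = w j.
    move=> cij; apply: (mulfI l0); apply: (mulfI (d0 i)).
    have e k : adj i k = adj j k by rewrite !adjE cij.
    have de : d i = d j by congr _%:R; apply: eq_card => k; rewrite !inE e.
    rewrite mulrCA mulrA -ws de [RHS]mulrCA mulrA -ws.
    by apply: eq_bigl.
  have w_adj i j : adj i j -> w j = (1 - x) * w i.
    move=> ij; apply: (mulfI (d0 i)); rewrite mulrCA mulrA -ws mulr_natl.
    rewrite -sumr_const; apply: eq_bigr => k ik.
    by apply: w_c; apply: two ik; rewrite adj_sym adj_sym.
  have /card_gt0P[q pq] := deg_gt0 adj_conn n_gt1 p.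
  rewrite inE in pq; have wq := w_adj _ _ pq; rewrite adj_sym in pq.
  have := w_adj _ _ pq; rewrite wq => wp.
  have /eqP : w p * (x * (x - 2)) = 0.
    transitivity ((1 - x) * ((1 - x) * w p) - w p); first by ring.
    by rewrite -wp subrr.
  rewrite !mulf_eq0 (negPf wp0) subr_eq0 /= => /orP[]/eqP ->; first by left.
  by right; right.
move=> [->|[->|->]]; first exact: eigenvalue_normLap0.
  by apply: multipartite_eigenvalue1; rewrite r2.
(* The eigenfunction for 2 is the sign of the side. *)
apply/eigenvalue_normLapP => //; exists (fun i => (-1) ^+ (c i)).
  by exists (Ordinal (ltnW n_gt1)); rewrite signr_eq0.
move=> j; rewrite (eq_bigr (fun=> - (-1) ^+ (c j))) => [|i].
  by rewrite sumr_const -mulr_natl; ring.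
rewrite adjE -val_eqE /=; move: (c_lt2 i) (c_lt2 j).
by case: (nat_of_ord (c i)) (nat_of_ord (c j)) => [|[|?]] [|[|?]] //; rewrite ?expr0 ?expr1 ?opprK.
Qed.

Section Balanced.
Variable k : nat.
Hypothesis card_c : forall i, #|[pred x | c x == i]| = k.

Lemma balanced_deg i : deg adj i = (n - k)%N.
Proof.
have := cardC [pred x | c x == c i]; rewrite card_ord card_c => cardC.
rewrite -[X in (X - _)%N]cardC addKn; apply: eq_card => x.
by rewrite !inE adjE eq_sym.
Qed.

Lemma balanced_size_gt0 : (0 < k)%N.
Proof.
by rewrite -(card_c (c (Ordinal n_gt1))); apply/card_gt0P; exists (Ordinal n_gt1); rewrite inE.
Qed.

(** With [S] the total of [w] and [s j] its sum over the class of [j], the eigenvalue equation reads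
    [S - s j = (1 - x) D w j]. Summing over a class determines [s j] unless [x = 1 + k / D]; then,
    for [x != 1], [w] is constant and [x = 0]. *)
Lemma eigenvalue_balanced x : (r < n)%N ->
  eigenvalue L x <-> x = 0 \/ x = 1 \/ x = 1 + k%:R / (n - k)%:R.
Proof.
move=> lt_rn; pose D : R := (n - k)%:R.
have D0 : D != 0 by rewrite gt_eqF // /D -(balanced_deg (Ordinal n_gt1)) degR_gt0.
split=> [/eigenvalue_normLapP - /(_ adj_sym adj_conn n_gt1)[w [p wp0] ws]|].
  case: (eqVneq x 1) => [|x1]; first by right; left.
  case: (eqVneq x (1 + k%:R / D)) => [|x2]; first by right; right.
  left; have l0 : 1 - x != 0 by rewrite subr_eq0 eq_sym.
  have l1 : (1 - x) * D + k%:R != 0.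
    apply: contraNneq x2 => e; apply/eqP; apply: (mulIf D0).
    rewrite mulrDl divfK // mul1r; apply/eqP; rewrite -subr_eq0 -oppr_eq0 -e.
    by apply/eqP; ring.
  pose S := \sum_i w i; pose s j := \sum_(i | c i == c j) w i.
  have wE j : S - s j = (1 - x) * D * w j by rewrite /D -multipartite_sum ws balanced_deg.
  have sE j : ((1 - x) * D + k%:R) * s j = k%:R * S.
    have : \sum_(i | c i == c j) (S - s i) = (1 - x) * D * s j.
      by rewrite mulr_sumr; apply: eq_bigr => i _; rewrite wE.
    rewrite (eq_bigr (fun=> S - s j)) => [|i /eqP cij]; last by rewrite /s cij.
    rewrite sumr_const card_c -mulr_natl => e; rewrite mulrDl -e; ring.
  have w_const i : w i = w p.
    apply: (mulfI (mulf_neq0 l0 D0)); rewrite -!wE; congr (_ - _).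
    by apply: (mulfI l1); rewrite !sE.
  have := ws p; rewrite (eq_bigr (fun=> w p)) => [|i _ //].
  rewrite sumr_const -mulr_natl -/(deg adj p) balanced_deg -/D => /eqP.
  rewrite -subr_eq0 => /eqP e; have /eqP : x * (D * w p) = 0 by rewrite -e; ring.
  by rewrite !mulf_eq0 (negPf D0) (negPf wp0) !orbF => /eqP.
move=> [->|[->|->]]; first exact: eigenvalue_normLap0.
  exact: multipartite_eigenvalue1.
apply/eigenvalue_normLapP => //.
pose p := Ordinal n_gt1; have /card_gt0P[q] := deg_gt0 adj_conn n_gt1 p.
rewrite inE adjE => cpq.
(* Classes of equal size make the total of this difference of class indicators zero, so its
   neighbour sum at [j] is [- k] times its value there. *)
exists (fun i => (c i == c p)%:R - (c i == c q)%:R).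
  by exists p; rewrite eqxx (negPf cpq) subr0 oner_eq0.
have total a : \sum_i (c i == a)%:R = k%:R :> R.
  by rewrite -(card_c a) -sumr_const [RHS]big_mkcond; apply: eq_bigr => i _; rewrite inE; case: eqP.
move=> j; rewrite multipartite_sum sumrB !total subrr sub0r balanced_deg -/D.
rewrite (eq_bigr (fun=> (c j == c p)%:R - (c j == c q)%:R)) => [|i /eqP -> //].
rewrite sumr_const card_c -[_ *+ k]mulr_natl.
by field.
Qed.
End Balanced.

End Multipartite.

(** * Structure of graphs whose non-adjacent vertices are twins *)

Section TwinGraph.
Variables (n : nat) (adj : rel 'I_n).
Hypotheses (adj_sym : symmetric adj) (adj_irr : irreflexive adj).
Hypothesis twins : forall i j, ~~ adj i j -> adj i =1 adj j.

(** The sides are the neighbours and the non-neighbours of [i0]: the former are pairwise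
    non-adjacent for lack of triangles, the latter are twins of [i0]. Hence [s] counts the
    non-neighbours. *)
Lemma triangle_free_iso i0 j0 : adj i0 j0 ->
  (forall x y z, adj x y -> adj x z -> ~~ adj y z) ->
  exists s : nat, [/\ (1 <= s)%N, (s <= n - 1)%N &
    graph_iso adj (Kmulti (fun i : 'I_2 => if i == ord0 then s else (n - s)%N))].
Proof using adj_sym adj_irr twins.
move=> adj_ij no_triangle; exists (n - deg adj i0)%N.
have deg_le : (deg adj i0 <= n)%N by rewrite -[X in (_ <= X)%N]card_ord max_card.
have deg_gt0 : (0 < deg adj i0)%N by apply/card_gt0P; exists j0.
have deg_lt : (deg adj i0 < n)%N.
  rewrite -[X in (_ < X)%N]card_ord; apply: proper_card; apply/properP; split.
    by apply/subsetP.
  by exists i0; rewrite // inE adj_irr.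
split; [by rewrite subn_gt0 | by rewrite leq_sub2l | ].
pose c x : 'I_2 := if adj i0 x then ord_max else ord0.
apply: (graph_iso_of_coloring (c := c)) => [i | x y].
  case: (eqVneq i ord0) => [-> | i0']; last first.
    have -> : i = ord_max by apply/val_inj; case: i i0' => [[|[]]].
    rewrite subKn //; apply: eq_card => x; rewrite !inE /c.
    by case: (adj i0 x).
  rewrite -nonadjacent_card; apply: eq_card => x; rewrite !inE /c.
  by case: (adj i0 x).
rewrite /c; case: (boolP (adj i0 x)) => x0; case: (boolP (adj i0 y)) => y0.
- exact/negbTE/(no_triangle i0).
- by rewrite adj_sym -(twins y0) x0.
- by rewrite -(twins x0) y0.
- by rewrite -(twins x0) (negPf y0).
Qed.

(** Twins have equal degrees. Adjacent [u] and [v] each miss at most one vertex of the triangle, so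
    they have a common neighbour in it and [tri] applies. *)
Lemma triangle_regular x y z : adj x y -> adj x z -> adj y z ->
  (forall u v t, adj u v -> adj u t -> adj v t -> deg adj u = deg adj v) ->
  forall u v, deg adj u = deg adj v.
Proof using adj_sym twins.
move=> xy xz yz tri u v; case: (boolP (adj u v)) => [uv | /twins uv]; last first.
  by apply: eq_card => w; rewrite !inE uv.
have at_most_one w a b : adj a b -> ~~ adj w a -> adj w b.
  by move=> ab wa; rewrite (twins wa).
have [t ut vt] : exists2 t, adj u t & adj v t.
  case: (boolP (adj u x)) => ux; case: (boolP (adj v x)) => vx; first by exists x.
  - have [vy vz] := (at_most_one _ _ _ xy vx, at_most_one _ _ _ xz vx).
    case: (boolP (adj u y)) => uy; first by exists y.
    by exists z => //; apply: at_most_one yz uy.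
  - have [uy uz] := (at_most_one _ _ _ xy ux, at_most_one _ _ _ xz ux).
    case: (boolP (adj v y)) => vy; first by exists y.
    by exists z => //; apply: at_most_one yz vy.
  - by exists y; [apply: at_most_one xy ux | apply: at_most_one xy vx].
exact: tri uv ut vt.
Qed.

(** Non-adjacency is an equivalence relation whose classes are the parts, and regularity gives them
    equal size [k]. The triangle meets three classes, so [r >= 3]; the class of [p] also contains
    [q], so [k > 1] and [r < n]. *)
Lemma balanced_iso x y z p q : adj x y -> adj x z -> adj y z ->
  (forall u v, deg adj u = deg adj v) -> p != q -> ~~ adj p q ->
  exists r k : nat, [/\ (3 <= r)%N, (r <= n - 1)%N, (r * k)%N = n &
    graph_iso adj (Kmulti (fun _ : 'I_r => k))].
Proof using adj_sym adj_irr twins.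
move=> xy xz yz regular neq_pq npq.
pose cls u := [set v | ~~ adj u v]; pose P := [set cls u | u : 'I_n].
have cls_eq u v : (cls u == cls v) = ~~ adj u v.
  apply/eqP/idP => [e | /twins e]; last by apply/setP => w; rewrite !inE e.
  by have /setP/(_ v) := e; rewrite !inE adj_irr => ->.
have clsP u : cls u \in P by apply: imset_f.
pose c u : 'I_#|P| := enum_rank_in (clsP x) (cls u).
have adjE u v : adj u v = (c u != c v).
  apply: negb_inj; rewrite negbK -cls_eq; apply/eqP/eqP => [e | ]; first by rewrite /c e.
  by rewrite /c => /(congr1 enum_val); rewrite !enum_rankK_in.
pose k := (n - deg adj p)%N.
have card_cls u : #|cls u| = k.
  by rewrite cardsE nonadjacent_card (regular u p).
have card_c i : #|[pred u | c u == i]| = k.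
  have /imsetP[u _ iu] := enum_valP i; rewrite -(card_cls u); apply: eq_card => v.
  have -> : i = c u by apply: enum_val_inj; rewrite enum_rankK_in.
  by rewrite !inE -[_ == _]negbK -adjE adj_sym.
have rk : (#|P| * k)%N = n.
  rewrite -[RHS]card_ord -[RHS]sum1_card [RHS](partition_big c xpredT) //=.
  rewrite (eq_bigr (fun=> k)) => [|i _]; first by rewrite sum_nat_const card_ord.
  by rewrite sum1_card card_c.
have r_ge3 : (3 <= #|P|)%N.
  rewrite -[X in (_ <= X)%N]card_ord.
  have /card_uniqP card3 : uniq [:: c x; c y; c z].
    by rewrite /= !inE negb_or -!adjE xy xz yz.
  by rewrite -[3%N]card3 max_card.
have k_gt1 : (1 < k)%N.
  rewrite -(card_cls p); apply/card_gt1P; exists p, q.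
  by rewrite !inE adj_irr npq.
exists #|P|, k; split=> //; last exact: graph_iso_of_coloring adjE.
have lt_rn : (#|P| < n)%N by rewrite -[X in (_ < X)%N]rk ltn_Pmulr // (leq_trans _ r_ge3).
by rewrite subn1 -ltnS prednK // (leq_ltn_trans _ lt_rn).
Qed.

End TwinGraph.

Theorem theorem2p1 (R : rcfType) (n : nat) (adj : rel 'I_n)
  (Hsym : symmetric adj) (Hirr : irreflexive adj)
  (Hconn : connected_graph adj) (Hn : (3 <= n)%N) :
  (exists a b c : R,
     [/\ a != b, a != c, b != c,
         (forall x : R, eigenvalue (normLap R adj) x <-> (x = a \/ x = b \/ x = c))
       & (a = 1 \/ b = 1 \/ c = 1)])
  <->
  ((exists s : nat, [/\ (1 <= s)%N, (s <= n - 1)%N &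
       graph_iso adj (Kmulti (fun i : 'I_2 => if i == ord0 then s else (n - s)%N))])
   \/
   (exists (r k : nat), [/\ (3 <= r)%N, (r <= n - 1)%N, (r * k)%N = n &
       graph_iso adj (Kmulti (fun _ : 'I_r => k))])).
Proof.
have n_gt1 : (1 < n)%N by apply: ltnW.
split=> [[a [b [c [_ _ _ spec one]]]] | ].
  have eig1 : eigenvalue (normLap R adj) 1.
    by apply/spec; case: one => [<-|[<-|<-]]; [left | right; left | right; right].
  have [e spec_sub] : exists e : R,
      forall x, eigenvalue (normLap R adj) x -> x \in [:: 0; 1; e].
    have /spec zero := eigenvalue_normLap0 R Hsym Hconn n_gt1.
    have n01 : (0 : R) <> 1 by move=> /esym/eqP; rewrite oner_eq0.
    have memE (e x : R) : x = 0 \/ x = 1 \/ x = e -> x \in [:: 0; 1; e].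
      by rewrite !inE; case=> [->|[->|->]]; rewrite eqxx ?orbT.
    (* Two of [a], [b], [c] are 0 and 1; the remaining one is [e]. *)
    case: zero one => [|[|]] z0 [|[|]] z1; try (by case: n01; rewrite z0 z1);
    [exists c | exists b | exists c | exists a | exists b | exists a];
    by move=> x /spec h; apply: memE; rewrite ?z0 -?z1; tauto.
  have [C codeg] := codegree_identity Hsym Hconn n_gt1 spec_sub.
  have twins := nonadjacent_twins Hsym Hconn n_gt1 Hirr codeg.
  have tri := triangle_deg Hsym Hconn n_gt1 Hirr codeg.
  case: (boolP [exists x, exists y, exists z, [&& adj x y, adj x z & adj y z]]).
    move=> /existsP[x /existsP[y /existsP[z /and3P[xy xz yz]]]]; right.
    have [p [q [neq_pq npq]]] := eigenvalue1_nonadjacent Hsym Hconn n_gt1 Hirr eig1.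
    apply: (balanced_iso Hsym Hirr twins xy xz yz _ neq_pq npq).
    exact: (triangle_regular Hsym twins xy xz yz tri).
  move=> no_triangle; left; pose o := Ordinal n_gt1.
  have /card_gt0P[j oj] := deg_gt0 Hconn n_gt1 o.
  apply: (triangle_free_iso Hsym Hirr twins oj) => x y z xy xz.
  apply: contra no_triangle => yz.
  apply/existsP; exists x; apply/existsP; exists y; apply/existsP; exists z.
  exact/and3P.
move=> [[s [s_gt0 s_lt /coloring_of_graph_iso[c card_c adjE]]]
       |[r [k [r_ge3 r_lt rk /coloring_of_graph_iso[c card_c adjE]]]]].
  exists 0, 1, 2; split; [| | | |by right; left].
  - by rewrite eq_sym oner_eq0.
  - by rewrite eq_sym pnatr_eq0.
  - by rewrite (eqr_nat R 1 2).
  - by move=> x; apply: (eigenvalue_bipartite Hconn n_gt1 adjE).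
have k_gt0 := balanced_size_gt0 n_gt1 card_c.
have lt_kn : (0 < n - k)%N.
  by rewrite -(balanced_deg adjE card_c (Ordinal n_gt1)) deg_gt0.
have q_gt0 : (0 : R) < k%:R / (n - k)%:R by rewrite divr_gt0 ?ltr0n.
(* As [r k = n], the third eigenvalue is [r / (r - 1)]. *)
exists 0, 1, (1 + k%:R / (n - k)%:R); split; [| | | |by right; left].
- by rewrite eq_sym oner_eq0.
- by rewrite lt_eqF // addr_gt0.
- by rewrite lt_eqF // ltrDl.
- move=> x; apply: (eigenvalue_balanced Hconn n_gt1 adjE card_c).
  by rewrite -ltnS subn1 prednK ?ltnS // (ltnW n_gt1) in r_lt.
Qed.
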